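(* Suppose $Z(t)$, $t\ge0$, is a stochastic process with regenerative increments over the renewal times $T_n$ such that $\mu:=\mathbb{E}[T_1]$ and $a:=\mathbb{E}[Z(T_1)]/\mu$ are finite. In addition, let $M_1:=\sup_{0\le t\le T_1}|Z(t)|$. (i) (Weak law of large numbers.) If $M_1<\infty$ almost surely, then $Z(t)/t\to a$ in probability as $t\to\infty$. (ii) (Strong law of large numbers.) If $\mathbb{E}[M_1]<\infty$, then $Z(t)/t\to a$ almost surely as $t\to\infty$.
   Context: Renewal times: $T_0:=0$ and $T_n:=\sum_{i=1}^n\xi_i$ for $n\ge 1$, where $(\xi_i)_{i\ge1}$ are i.i.d. strictly positive random variables (so $0<T_1<T_2<\cdots$ and $\xi_n=T_n-T_{n-1}$). $Z=(Z(t))_{t\ge0}$ is a real-valued stochastic process with continuous time parameter $t\in[0,\infty)$ and càdlàg (right-continuous with left limits) paths. The process $Z(t)$ has regenerative increments over the times $T_n$ if $Z(0)=0$ and the increments $$\zeta_n:=\bigl(\xi_n,\ \{Z(t+T_{n-1})-Z(T_{n-1}):0\le t\le\xi_n\}\bigr),\qquad n\ge1,$$ are i.i.d. Here the second component, defined on the random interval $[0,\xi_n]$, is regarded as a process on $[0,\infty)$ stopped at $\xi_n$, i.e. equal to $Z(\xi_n+T_{n-1})-Z(T_{n-1})$ for all $t\ge\xi_n$, so it is a random càdlàg function on $[0,\infty)$. *)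

(* Defs.v *)
From mathcomp Require Export all_boot all_order all_algebra finmap.
From mathcomp Require Export all_classical all_reals all_analysis.
Export Order.TTheory GRing.Theory Num.Theory.
Export numFieldNormedType.Exports.

Set Implicit Arguments.
Unset Strict Implicit.
Unset Printing Implicit Defensive.

Local Open Scope classical_set_scope.
Local Open Scope ring_scope.

Definition independent d d' (T : measurableType d) (E : measurableType d')
    (R : realType) (P : probability T R) (X : nat -> T -> E) : Prop :=
  forall (J : {fset nat}) (A : nat -> set E),
    (forall i, measurable (A i)) ->
    P (\bigcap_(i in [set` J]) (X i @^-1` A i)) =
      (\prod_(i <- J) P (X i @^-1` A i))%E.

Definition identically_distributed d d' (T : measurableType d)
    (E : measurableType d') (R : realType) (P : probability T R)
    (X : nat -> T -> E) : Prop :=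
  forall i j (A : set E), measurable A -> P (X i @^-1` A) = P (X j @^-1` A).

Definition iid d d' (T : measurableType d) (E : measurableType d')
    (R : realType) (P : probability T R) (X : nat -> T -> E) : Prop :=
  [/\ forall i, measurable_fun setT (X i),
      independent P X & identically_distributed P X].

(* The sigma-algebra on real functions on [0, +oo[ generated by the coordinate
   maps. Its trace on the set of cadlag functions is the usual sigma-algebra of
   the Skorokhod space, so that for elements with cadlag paths independence and
   equality in law mean the same for both. *)
Definition cylinders (R : realType) : set (set ({nonneg R} -> R)) :=
  [set C | exists (t : {nonneg R}) (B : set R),
     measurable B /\ C = [set f | B (f t)]].

Definition path_space (R : realType) := g_sigma_algebraType (@cylinders R).

Definition cadlag (R : realType) (f : R -> R) : Prop :=
  (forall t, 0 <= t -> f s @[s --> t^'+] --> f t) /\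
  (forall t, 0 < t -> exists l : R, f s @[s --> t^'-] --> l).

(* A process with time parameter in [0, +oo[ is a function of a real time whose
   values at negative times are irrelevant. *)
Definition cadlag_process d (T : measurableType d) (R : realType)
    (Z : R -> T -> R) : Prop :=
  (forall t, 0 <= t -> measurable_fun setT (Z t)) /\
  (forall w, cadlag (fun t => Z t w)).

(* xi is indexed from 0: xi n is the (n+1)-st inter-renewal time. *)
Definition renewal_time (T : Type) (R : realType) (xi : nat -> T -> R)
    (n : nat) (w : T) : R := \sum_(i < n) xi i w.

Definition value_at_renewal (T : Type) (R : realType) (xi : nat -> T -> R)
    (Z : R -> T -> R) (n : nat) (w : T) : R := Z (renewal_time xi n w) w.

(* The n-th increment (n counted from 0), over [T_n, T_(n+1)]; the minimum stops
   the path at xi n. *)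
Definition increment (T : Type) (R : realType) (xi : nat -> T -> R)
    (Z : R -> T -> R) (n : nat) (w : T) : R * path_space R :=
  (xi n w,
   fun t : {nonneg R} =>
     Z (Num.min t%:num (xi n w) + renewal_time xi n w) w
       - value_at_renewal xi Z n w).

Definition renewal_process d (T : measurableType d) (R : realType)
    (P : probability T R) (xi : nat -> T -> R) : Prop :=
  iid P xi /\ (forall n w, 0 < xi n w).

Definition regenerative_increments d (T : measurableType d) (R : realType)
    (P : probability T R) (xi : nat -> T -> R) (Z : R -> T -> R) : Prop :=
  (forall w, Z 0 w = 0) /\ iid P (increment xi Z).

(* M_1, which is +oo where Z is unbounded on [0, T_1] *)
Definition max_first_cycle (T : Type) (R : realType) (xi : nat -> T -> R)
    (Z : R -> T -> R) (w : T) : \bar R :=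
  ereal_sup [set `|Z t w|%:E | t in `[0, renewal_time xi 1 w]].

Definition cvg_in_probability d (T : measurableType d) (R : realType)
    (P : probability T R) (X : R -> T -> R) (l : R) : Prop :=
  forall e : R, 0 < e ->
    P [set w | e <= `|X t w - l|] @[t --> +oo%R] --> 0%E.

(* Main.v *)
Require Import Defs.
From mathcomp Require Import measurable_realfun ring lra.

(** Write zeta_n for the n-th increment, T_n for the renewal times, and set
    D_n := Z(T_(n+1)) - Z(T_n) - a xi_n.  The D_n are i.i.d. with mean zero by
    the choice of a.  If T_n <= t < T_(n+1), then Z(t) - a t is the sum of
    D_0, ..., D_(n-1) plus an error made inside the n-th cycle, which is at most
    H_n := M_(n+1) + |a| xi_n, where M_(n+1) is the supremum of the n-th
    increment ([centered_process_bound]).  By the strong law of large numbers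
    the sum is o(n) and T_n / n tends to mu > 0, so that n = O(t), almost
    surely.  Both laws thus come down to showing that H_n is o(t) for the cycle
    n that covers t.

    For the strong law, H is i.i.d. and integrable, and a sequence whose
    averages converge satisfies H_n = o(n).

    For the weak law there is no moment on M_1, and the cycle that covers t is
    biased towards long cycles.  What is needed is that H of the covering cycle
    is tight, uniformly in t.  Choose c > 0 with p := P(xi_0 >= c) > 0.  At most
    one renewal time in a window of length c is followed by a cycle of length at
    least c, and T_n is independent of zeta_n; hence the expected number of
    renewal times in any such window is at most 1/p ([renewal_window_bound]).
    Splitting the cycles that cover t according to the window, counted backwards
    from t, that contains their starting time gives
    P(zeta of the cycle covering t is in B)
      <= (1/p) sum_k P(zeta_0 in B, xi_0 > k c)
      <= (1/p) E[(xi_0 / c + 1) 1(zeta_0 in B)]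
    ([covering_cycle_bound], [sum_tail_prob_le]).  With B the event that H
    exceeds K the right-hand side tends to 0 as K grows, by dominated
    convergence.

    The strong law of large numbers itself is obtained from the following
    maximal argument.  Let X be i.i.d. with negative mean, let M_n be the
    maximum of 0 and of the first n partial sums, and let M'_n be the same for
    the shifted sequence X_1, X_2, ...; then M_(n+1) = max(0, X_0 + M'_n).  The
    event A that M_n is unbounded is shift invariant, so that M'_n and M_n have
    the same integral over A, and M_(n+1) - M'_n has a nonnegative one.  On A
    this difference is eventually X_0, and it is dominated by |X_0|; so the
    integral of X_0 over A is nonnegative.  But A is determined by X_1, X_2, ...
    and so independent of X_0: the integral is P(A) E[X_0], whence P(A) = 0
    ([negative_drift_bounded]).

    All independence statements come from [iid_remove_one]: removing one term
    from an i.i.d. sequence leaves a sequence with the same law that is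
    independent of the removed term. *)

Set Implicit Arguments.
Unset Strict Implicit.
Unset Printing Implicit Defensive.

Local Open Scope classical_set_scope.
Local Open Scope ring_scope.

(** * Laws of i.i.d. sequences *)

(** Requiring A i = setT from some rank on makes these sets a pi-system
    whose probability is given by the finite products of independence. *)
Definition cylinder_seq d (E : measurableType d) : set (set (nat -> E)) :=
  [set B | exists A : nat -> set E,
     [/\ forall i, measurable (A i),
         exists n, forall i, (n <= i)%N -> A i = setT &
         B = [set f | forall i, A i (f i)]]].

Definition seq_space d (E : measurableType d) :=
  g_sigma_algebraType (@cylinder_seq d E).

Lemma setI_closed_cylinder_seq d (E : measurableType d) :
  setI_closed (@cylinder_seq d E).
Proof.
move=> _ _ [A [mA [n An] ->]] [B [mB [m Bm] ->]].
exists (fun i => A i `&` B i); split.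
- by move=> i; exact: measurableI.
- exists (maxn n m) => i; rewrite geq_max => /andP[ni mi].
  by rewrite An// Bm// setIT.
- apply/seteqP; split=> [f [fA fB] i|f fAB]; first by split.
  by split=> i; case: (fAB i).
Qed.

Lemma measurable_coord d (E : measurableType d) (n : nat) :
  measurable_fun setT (fun f : seq_space E => (f n : E)).
Proof.
move=> _ B mB; rewrite setTI; apply: sub_sigma_algebra.
exists (fun i => if i == n then B else setT); split.
- by move=> i; case: ifP.
- by exists n.+1 => i ni; rewrite gtn_eqF.
- apply/seteqP; split=> [f fB i|f /(_ n)]; last by rewrite eqxx.
  by case: eqP => // ->.
Qed.

Lemma measurable_to_seq_space d d' (T : measurableType d)
    (E : measurableType d') (X : nat -> T -> E) :
  (forall i, measurable_fun setT (X i)) ->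
  measurable_fun setT (fun w => (fun i => X i w) : seq_space E).
Proof.
move=> mX.
apply: (@measurability _ _ _ (seq_space E) setT _ (@cylinder_seq _ E)) => //.
move=> _ [_ [A [mA _ ->]] <-]; rewrite setTI.
rewrite (_ : _ @^-1` _ = \bigcap_i (X i @^-1` A i)); last first.
  by apply/seteqP; split=> [w + i _|w + i] => /(_ i); [apply|apply].
by apply: bigcapT_measurable => i; rewrite -[_ @^-1` _]setTI; exact: mX.
Qed.

(** Independence over a finite set of indices, in the form that
    reindexing lemmas for products over ordinals can act upon. *)
Lemma independent_initial d d' (T : measurableType d) (E : measurableType d')
    (R : realType) (P : probability T R) (X : nat -> T -> E)
    (n : nat) (A : nat -> set E) :
  independent P X -> (forall i, measurable (A i)) ->
  (forall i, (n <= i)%N -> A i = setT) ->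
  P [set w | forall i, A i (X i w)] = (\prod_(i < n) P (X i @^-1` A i))%E.
Proof.
move=> iX mA An; have := iX [fset i in iota 0 n]%fset A mA.
rewrite (perm_big (index_iota 0 n)); last first.
  by rewrite /index_iota subn0; apply: uniq_perm;
    rewrite ?fset_uniq ?iota_uniq// => i; rewrite in_fset.
rewrite big_mkord => <-; congr (P _); apply/seteqP; split=> [w + i _|w wA i].
  exact.
have [ni|ni] := leqP n i; first by rewrite An.
by apply: wA; rewrite /= in_fset mem_iota.
Qed.

(** [bump k] enumerates the indices different from k, so
    both sides are the product of P(X_k in C) and the P(X_i in A_i): on the
    left with X_i replaced by the equidistributed X_(bump k i). *)
Lemma iid_remove_one_cylinder d d' (T : measurableType d)
    (E : measurableType d') (R : realType) (P : probability T R)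
    (X : nat -> T -> E) (k : nat) (C : set E) (A : nat -> set E) (n : nat) :
  iid P X -> measurable C -> (forall i, measurable (A i)) ->
  (forall i, (n <= i)%N -> A i = setT) ->
  P ((X k @^-1` C) `&` [set w | forall i, A i (X (bump k i) w)]) =
  (P (X k @^-1` C) * P [set w | forall i, A i (X i w)])%E.
Proof.
move=> [mX iX idX] mC mA An; pose N := maxn n k.
pose A' j := if j == k then C else A (unbump k j).
have mA' i : measurable (A' i) by rewrite /A'; case: ifP.
have A'N i : (N.+1 <= i)%N -> A' i = setT.
  rewrite /N gtn_max => /andP[ni ki]; rewrite /A' gtn_eqF//.
  by rewrite An// /unbump ki subn1 -ltnS prednK// (leq_ltn_trans _ ki).
rewrite (_ : _ `&` _ = [set w | forall i, A' i (X i w)]); last first.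
  apply/seteqP; split=> [w [wC wA] i|w wA'].
    rewrite /A'; case: eqP => [->//|/eqP ik].
    by have := wA (unbump k i); rewrite unbumpK// inE.
  split=> [|i]; first by have := wA' k; rewrite /A' eqxx.
  have := wA' (bump k i); rewrite /A' bumpK.
  by rewrite eq_sym (negbTE (neq_bump _ _)).
rewrite (independent_initial iX mA' A'N).
have kN : (k < N.+1)%N by rewrite ltnS leq_maxr.
rewrite (bigD1_ord (Ordinal kN))//= {1}/A' eqxx; congr (_ * _)%E.
rewrite (@independent_initial _ _ _ _ _ _ _ N)//; last first.
  by move=> i; rewrite /N geq_max => /andP[/An].
apply: eq_bigr => i _; rewrite /A' eq_sym (negbTE (neq_bump _ _)) bumpK.
exact: idX.
Qed.

(** Both sides are measures in B which agree on cylinders.  For k = 0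
    the remaining sequence is the shifted one; for general k its first k terms
    are those of X, the past of X_k. *)
Lemma iid_remove_one d d' (T : measurableType d) (E : measurableType d')
    (R : realType) (P : probability T R) (X : nat -> T -> E) (k : nat)
    (C : set E) (B : set (seq_space E)) :
  iid P X -> measurable C -> measurable B ->
  P ((X k @^-1` C) `&` [set w | B (fun i => X (bump k i) w)]) =
  (P (X k @^-1` C) * P [set w | B (fun i => X i w)])%E.
Proof.
move=> iidX mC mB; have [mX _ _] := iidX.
have mXC : measurable (X k @^-1` C) by rewrite -[_ @^-1` _]setTI; exact: mX.
have mpre (s : nat -> nat) (S : set (seq_space E)) : measurable S ->
    measurable [set w | S (fun i => X (s i) w)].
  move=> mS; rewrite -[X in measurable X]setTI.
  exact: (measurable_to_seq_space (fun i => mX (s i))).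
pose Q (S : set (seq_space E)) :=
  P ((X k @^-1` C) `&` [set w | S (fun i => X (bump k i) w)]) =
  (P (X k @^-1` C) * P [set w | S (fun i => X i w)])%E.
apply: (@dynkin_induction _ (seq_space E) (@cylinder_seq _ E) Q) => //.
- exact: setI_closed_cylinder_seq.
- rewrite /Q [X in P (_ `&` X)](_ : _ = setT)//.
  rewrite [X in (_ * P X)%E](_ : _ = setT)//.
  by rewrite setIT probability_setT mule1.
- move=> _ [A [mA [n An] ->]].
  exact: (@iid_remove_one_cylinder _ _ _ _ _ _ _ _ _ _ n).
- move=> S mS QS; rewrite /Q.
  rewrite [X in P (_ `&` X)](_ : _ =
    ~` [set w | S (fun i => X (bump k i) w)])//.
  rewrite [X in (_ * P X)%E](_ : _ = ~` [set w | S (fun i => X i w)])//.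
  rewrite probability_setC; last exact: (mpre id).
  rewrite -setDE measureD//; [|exact: (mpre (bump k))|].
    rewrite [X in (_ - X)%E]QS muleBr ?mule1 ?fin_num_measure//.
    by rewrite -ge0_fin_numE ?fin_num_measure.
- move=> F mF tF QF; rewrite /Q.
  rewrite [X in P (_ `&` X)](_ : _ =
    \bigcup_n [set w | F n (fun i => X (bump k i) w)])//.
  rewrite [X in (_ * P X)%E](_ : _ =
    \bigcup_n [set w | F n (fun i => X i w)])//.
  rewrite setI_bigcupr measure_bigcup//=; last 2 first.
  + by move=> n _; apply: measurableI => //; exact: (mpre (bump k)).
  + apply/trivIsetP => i j _ _ ij; apply/seteqP; split=> // w [[_ Fi] [_ Fj]].
    by have /trivIsetP/(_ i j I I ij)/seteqP[/(_ _ (conj Fi Fj))] := tF.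
  rewrite measure_bigcup//=; last 2 first.
  + by move=> n _; exact: (mpre id).
  + apply/trivIsetP => i j _ _ ij; apply/seteqP; split=> // w [Fi Fj].
    by have /trivIsetP/(_ i j I I ij)/seteqP[/(_ _ (conj Fi Fj))] := tF.
  have <- : (fine (P (X k @^-1` C)))%:E = P (X k @^-1` C).
    by rewrite fineK ?fin_num_measure.
  rewrite -nneseriesZl//; apply: eq_eseriesr => n _.
  by rewrite fineK ?fin_num_measure//; exact: QF.
Qed.

Lemma iid_bump_law d d' (T : measurableType d) (E : measurableType d')
    (R : realType) (P : probability T R) (X : nat -> T -> E) (k : nat)
    (B : set (seq_space E)) :
  iid P X -> measurable B ->
  P [set w | B (fun i => X (bump k i) w)] = P [set w | B (fun i => X i w)].
Proof.
move=> iidX mB; have := iid_remove_one k iidX measurableT mB.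
by rewrite preimage_setT setTI probability_setT mul1e.
Qed.

Lemma iid_remove_one_independent d d' (T : measurableType d)
    (E : measurableType d') (R : realType) (P : probability T R)
    (X : nat -> T -> E) (k : nat) (C : set E) (B : set (seq_space E)) :
  iid P X -> measurable C -> measurable B ->
  P ((X k @^-1` C) `&` [set w | B (fun i => X (bump k i) w)]) =
  (P (X k @^-1` C) * P [set w | B (fun i => X (bump k i) w)])%E.
Proof. by move=> iidX mC mB; rewrite (iid_bump_law k iidX) ?iid_remove_one. Qed.

Lemma iid_comp d d1 d2 (T : measurableType d) (E1 : measurableType d1)
    (E2 : measurableType d2) (R : realType) (P : probability T R)
    (X : nat -> T -> E1) (f : E1 -> E2) :
  measurable_fun setT f -> iid P X -> iid P (fun n w => f (X n w)).
Proof.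
move=> mf [mX iX idX]; have mf' A : measurable A -> measurable (f @^-1` A).
  by move=> mA; rewrite -[_ @^-1` _]setTI; exact: mf.
split=> [i|J A mA|i j A mA]; first exact: measurableT_comp.
  by rewrite -(iX J (fun i => f @^-1` A i)) => // i; exact: mf'.
by rewrite -(idX i j (f @^-1` A)) => //; exact: mf'.
Qed.

(** * Integrals and laws *)

Lemma integral_mrestrT d (T : measurableType d) (R : realType)
    (mu : {measure set T -> \bar R}) (A : set T) (mA : measurable A)
    (f : T -> \bar R) :
  measurable_fun setT f -> (forall x, 0 <= f x)%E ->
  (\int[mrestr mu mA]_x f x = \int[mu]_(x in A) f x)%E.
Proof.
move=> mf f0; rewrite (@ge0_negligible_integral _ _ _ _ setT (~` A))//.
- rewrite setTD setCK; apply: eq_measure_integral => B mB BA.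
  by rewrite /= /mrestr setIidl.
- exact: measurableC.
- by rewrite /= /mrestr setICl measure0.
Qed.

(** The constant c and the events A, A' let this single transfer
    principle serve three purposes: equality in law (c = 1, A = A' = setT),
    shift invariance on an event (c = 1), and independence from an event A
    (c = P(A), A' = setT). *)
Lemma ge0_integral_eq_law d d' (T : measurableType d) (E : measurableType d')
    (R : realType) (mu : {measure set T -> \bar R}) (X X' : T -> E)
    (A A' : set T) (c : {nonneg R}) (g : E -> \bar R) :
  measurable_fun setT X -> measurable_fun setT X' ->
  measurable A -> measurable A' ->
  measurable_fun setT g -> (forall x, 0 <= g x)%E ->
  (forall C, measurable C ->
     mu ((X @^-1` C) `&` A) = (c%:num%:E * mu ((X' @^-1` C) `&` A'))%E) ->
  (\int[mu]_(w in A) g (X w) = c%:num%:E * \int[mu]_(w in A') g (X' w))%E.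
Proof.
move=> mX mX' mA mA' mg g0 law.
pose X1 : {mfun T >-> E} := mfun_Sub (mem_set mX).
pose X2 : {mfun T >-> E} := mfun_Sub (mem_set mX').
have push (Y : {mfun T >-> E}) B (mB : measurable B) :
    (\int[mu]_(w in B) g (Y w) =
     \int[pushforward (mrestr mu mB) Y]_y g y)%E.
  have mY : measurable_fun setT Y by [].
  have := ge0_integral_pushforward mY (mrestr mu mB) measurableT mg.
  rewrite preimage_setT => ->//=.
  by rewrite integral_mrestrT//; exact: measurableT_comp.
rewrite (push X1 _ mA) (push X2 _ mA') -ge0_integral_mscale//.
by apply: eq_measure_integral => C mC _; exact: law.
Qed.

Lemma integral_independent_event d (T : measurableType d) (R : realType)
    (P : probability T R) (X : T -> R) (A : set T) :
  P.-integrable setT (EFin \o X) -> measurable A ->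
  (forall C, measurable C -> P ((X @^-1` C) `&` A) = (P (X @^-1` C) * P A)%E) ->
  (\int[P]_(w in A) (X w)%:E = P A * \int[P]_w (X w)%:E)%E.
Proof.
move=> iX mA indep; have mX : measurable_fun setT X.
  by apply/measurable_EFinP; exact: measurable_int iX.
have PAfin : P A \is a fin_num by rewrite fin_num_measure.
have c0 : 0 <= fine (P A) by rewrite fine_ge0.
pose c := NngNum c0.
have cE : P A = c%:num%:E by rewrite /= fineK.
have law C : measurable C ->
    P ((X @^-1` C) `&` A) = (c%:num%:E * P ((X @^-1` C) `&` setT))%E.
  by move=> mC; rewrite indep// cE setIT muleC.
have int (g : R -> \bar R) : measurable_fun setT g -> (forall x, 0 <= g x)%E ->
    (\int[P]_(w in A) g (X w) = P A * \int[P]_w g (X w))%E.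
  move=> mg g0; rewrite cE.
  exact: (ge0_integral_eq_law mX mX mA measurableT mg g0 law).
rewrite integralE [in RHS]integralE muleBr//; last first.
  by apply: fin_num_adde_defl; rewrite fin_numN integrable_neg_fin_num.
congr (_ - _)%E.
- rewrite (_ : (fun w => (X w)%:E)^\+%E = EFin^\+%E \o X);
    last exact: funepos_comp.
  by apply: int; [exact: measurable_funepos|exact: funepos_ge0].
- rewrite (_ : (fun w => (X w)%:E)^\-%E = EFin^\-%E \o X);
    last exact: funeneg_comp.
  by apply: int; [exact: measurable_funeneg|exact: funeneg_ge0].
Qed.

Lemma integrable_eq_law d d' (T : measurableType d) (E : measurableType d')
    (R : realType) (P : probability T R) (X X' : T -> E) (g : E -> \bar R) :
  measurable_fun setT X -> measurable_fun setT X' ->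
  measurable_fun setT g ->
  (forall C, measurable C -> P (X @^-1` C) = P (X' @^-1` C)) ->
  P.-integrable setT (g \o X') -> P.-integrable setT (g \o X).
Proof.
move=> mX mX' mg law /integrableP[_ ig]; apply/integrableP; split.
  exact: measurableT_comp.
have law1 C : measurable C ->
    P ((X @^-1` C) `&` setT) =
    ((1%:nng : {nonneg R})%:num%:E * P ((X' @^-1` C) `&` setT))%E.
  by move=> mC; rewrite !setIT mul1e law.
have mag : measurable_fun setT (abse \o g) by exact: measurableT_comp.
have := ge0_integral_eq_law mX mX' measurableT measurableT mag
  (fun x => abse_ge0 (g x)) law1.
by rewrite mul1e => ->.
Qed.

Lemma iid_integrable d (T : measurableType d) (R : realType)
    (P : probability T R) (X : nat -> T -> R) :
  iid P X -> P.-integrable setT (EFin \o X 0%N) ->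
  forall n, P.-integrable setT (EFin \o X n).
Proof.
move=> [mX _ idX] iX n.
by apply: (integrable_eq_law (mX n) (mX 0%N) _ _ iX) => // C mC; exact: idX.
Qed.

(** Dominated convergence for g times the indicator of F n. *)
Lemma integral_vanishing d (T : measurableType d) (R : realType)
    (P : probability T R) (F : nat -> set T) (g : T -> R) (e : R) :
  (forall n, measurable (F n)) -> P.-integrable setT (EFin \o g) -> 0 < e ->
  {ae P, forall w, \forall n \near \oo, ~ F n w} ->
  exists n, (\int[P]_(w in F n) (g w)%:E <= e%:E)%E.
Proof.
move=> mF ig e0 F0.
have mg : measurable_fun setT (EFin \o g) := measurable_int _ ig.
have : (\int[P]_(w in F n) (g w)%:E @[n --> \oo] --> 0)%E.
  have -> : (fun n => \int[P]_(w in F n) (g w)%:E)%E =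
            (fun n => \int[P]_w ((EFin \o g) \_ (F n)) w)%E.
    by apply/funext => n; rewrite -integral_mkcond.
  rewrite -[X in _ --> X](integral0 P setT).
  have := @dominated_convergence _ _ _ P setT measurableT
    (fun n => (EFin \o g) \_ (F n)) (cst 0%E) (abse \o (EFin \o g)).
  case=> //.
  - move=> n; apply/(measurable_restrictT _ (mF n)).
    exact: measurable_funTS.
  - apply: filterS F0 => w wF _; apply: cvg_near_cst.
    by apply: filterS wF => n nF; rewrite patchE memNset.
  - exact: integrable_abse.
  - apply: aeW => w n _; rewrite patchE; case: ifP => //= _.
    by rewrite normr0 lee_fin.
move=> /fine_cvgP[fin /cvgr_le/(_ _ e0) le_e].
near \oo => n; exists n.
rewrite -[leLHS]fineK; last by near: n.
by rewrite lee_fin; near: n.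
Unshelve. all: end_near. Qed.

Lemma probability_vanishing d (T : measurableType d) (R : realType)
    (P : probability T R) (F : nat -> set T) (e : R) :
  (forall n, measurable (F n)) -> 0 < e ->
  {ae P, forall w, \forall n \near \oo, ~ F n w} ->
  exists n, (P (F n) <= e%:E)%E.
Proof.
move=> mF e0 F0.
have i1 : P.-integrable setT (EFin \o cst (1 : R)).
  exact: finite_measure_integrable_cst.
have [n ne] := integral_vanishing mF i1 e0 F0; exists n.
by rewrite -[P (F n)]mul1e -integral_cst.
Qed.

(** The events that X < 1/(n+1) vanish.  The value 1/2 is
    arbitrary: any positive bound would do. *)
Lemma positive_bounded_below d (T : measurableType d) (R : realType)
    (P : probability T R) (X : T -> R) :
  measurable_fun setT X -> (forall w, 0 < X w) ->
  exists2 c, 0 < c & ((2^-1)%:E <= P [set w | (c <= X w)%R])%E.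
Proof.
move=> mX X0; pose F n := X @^-1` `]-oo, (n.+1%:R^-1)[%classic.
have mF n : measurable (F n).
  by rewrite -[X in measurable X]setTI; exact: mX.
have [] := @probability_vanishing _ _ _ P F 2^-1 mF.
- by rewrite invr_gt0.
- apply: aeW => w; near=> n; rewrite /F/= in_itv/=; apply/negP; rewrite -leNgt.
  rewrite -[leRHS]invrK lef_pV2 ?posrE// ?invr_gt0//.
  apply: (@le_trans _ _ n%:R); last by rewrite ler_nat.
  by near: n; exact: nbhs_infty_ger.
move=> n Fn; exists n.+1%:R^-1; first by rewrite invr_gt0.
rewrite (_ : [set w | _] = ~` F n); last first.
  by apply/seteqP; split=> w; rewrite /F/= in_itv/= leNgt => /negP.
rewrite probability_setC// leeBrDr ?fin_num_measure//.
apply: le_trans (leeD2l _ Fn) _.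
by rewrite -EFinD lee_fin; lra.
Unshelve. all: end_near. Qed.

Lemma expectation_gt0 d (T : measurableType d) (R : realType)
    (P : probability T R) (X : T -> R) :
  measurable_fun setT X -> (forall w, 0 < X w) ->
  (0 < \int[P]_w (X w)%:E)%E.
Proof.
move=> mX X0; have [c c0 Pc] := positive_bounded_below P mX X0.
have mC : measurable [set w | c <= X w].
  rewrite (_ : [set w | _] = setT `&` X @^-1` `[c, +oo[%classic).
    exact: mX.
  by rewrite setTI; apply/seteqP; split=> w /=; rewrite in_itv/= andbT.
apply: (@lt_le_trans _ _
  (\int[P]_(w in [set w | (c <= X w)%R]) (cst c%:E w))%E).
  rewrite integral_cst// mule_gt0//.
  by apply: lt_le_trans Pc; rewrite lte_fin invr_gt0.
apply: (@le_trans _ _ (\int[P]_(w in [set w | (c <= X w)%R]) (X w)%:E)%E).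
  apply: ge0_le_integral => //.
  - by move=> w _; rewrite lee_fin ltW.
  - by apply/measurable_EFinP; exact: measurable_funTS.
apply: ge0_subset_integral => //; first exact/measurable_EFinP.
by move=> w _; rewrite lee_fin ltW.
Qed.

Lemma mean_gt0 d (T : measurableType d) (R : realType)
    (P : probability T R) (X : T -> R) :
  P.-integrable setT (EFin \o X) -> (forall w, 0 < X w) ->
  0 < fine (\int[P]_w (X w)%:E).
Proof.
move=> iX X0; rewrite fine_gt0// expectation_gt0//=.
  by rewrite ltey_eq integrable_fin_num.
by apply/measurable_EFinP; exact: measurable_int iX.
Qed.

(** * The strong law of large numbers *)

(** The maximum of 0 and of the first n partial sums of f.  Recursion on the
    first term, rather than on the last sum, relates it to the shifted
    sequence. *)
Fixpoint max_walk (R : realType) (f : nat -> R) (n : nat) : R :=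
  if n is m.+1 then Num.max 0 (f 0%N + max_walk (fun i => f i.+1) m) else 0.

Lemma max_walk_ge0 (R : realType) (f : nat -> R) n : 0 <= max_walk f n.
Proof. by case: n => //= n; rewrite le_max lexx. Qed.

Lemma max_walkS (R : realType) (f : nat -> R) n :
  max_walk f n.+1 = Num.max 0 (f 0%N + max_walk (fun i => f i.+1) n).
Proof. by []. Qed.

Lemma max_walk_leS (R : realType) (f : nat -> R) n :
  max_walk f n <= max_walk f n.+1.
Proof.
elim: n f => [|n IH] f; first exact: max_walk_ge0.
rewrite max_walkS [leRHS]max_walkS ge_max le_max lexx/= le_max lerD2l IH.
by rewrite orbT.
Qed.

Lemma max_walk_homo (R : realType) (f : nat -> R) :
  {homo max_walk f : m n / (m <= n)%N >-> m <= n}.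
Proof. by apply: homo_leq; [|exact: le_trans|exact: max_walk_leS]. Qed.

Lemma sum_le_max_walk (R : realType) (f : nat -> R) n :
  \sum_(i < n) f i <= max_walk f n.
Proof.
elim: n f => [|n IH] f; first by rewrite big_ord0.
rewrite big_ord_recl max_walkS le_max; apply/orP; right.
by rewrite lerD2l; exact: IH.
Qed.

Lemma measurable_max_walk (R : realType) (n : nat) :
  measurable_fun setT (fun f : seq_space R => max_walk f n).
Proof.
elim: n => [|n IH]; first exact: measurable_cst.
have mshift : measurable_fun setT
    (fun f : seq_space R => (fun i => f i.+1) : seq_space R).
  by apply: measurable_to_seq_space => i; exact: measurable_coord.
apply: (@measurable_maxr _ _ _ _ (cst 0)
  (fun f : seq_space R => f 0%N + max_walk (fun i => f i.+1) n)) => //.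
apply: measurable_funD; first exact: measurable_coord.
exact: (measurableT_comp IH mshift).
Qed.

(** Unboundedness of the maxima, tested on integers to be a countable
    combination of measurable conditions. *)
Definition escaping (R : realType) : set (seq_space R) :=
  [set f | forall K : nat, exists n, K%:R < max_walk f n].

Lemma measurable_escaping (R : realType) : measurable (@escaping R).
Proof.
rewrite (_ : @escaping R =
  \bigcap_K \bigcup_n [set f | K%:R < max_walk f n]); last first.
  apply/seteqP; split=> f /=; first by move=> + K _ => /(_ K)[n]; exists n.
  by move=> + K => /(_ K I)[n _]; exists n.
apply: bigcapT_measurable => K; apply: bigcupT_measurable => n.
rewrite -[X in measurable X]setTI.
have -> : [set f : seq_space R | K%:R < max_walk f n] =
    (fun f : seq_space R => max_walk f n) @^-1` `]K%:R, +oo[%classic.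
  by apply/seteqP; split=> f /=; rewrite in_itv/= andbT.
exact: measurable_max_walk.
Qed.

(** By [max_walkS] the maxima for f and for the shifted sequence differ
    by at most the absolute value of f 0. *)
Lemma escaping_shift (R : realType) (f : nat -> R) :
  escaping (fun i => f i.+1) <-> escaping f.
Proof.
split=> escf K.
  have [n] := escf (Num.truncn (K%:R - f 0%N)).+1.
  move=> Kn; exists n.+1; rewrite max_walkS lt_max -ltrBlDl; apply/orP; right.
  by apply: lt_trans Kn; exact: truncnS_gt.
have [n] := escf (Num.truncn (K%:R + `|f 0%N|)).+1.
move=> Kn; exists n.
have : K%:R + `|f 0%N| < max_walk f n.+1.
  apply: lt_le_trans (max_walk_leS _ _); apply: lt_trans Kn.
  exact: truncnS_gt.
rewrite max_walkS lt_max => /orP[|].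
  by rewrite ltNge addr_ge0.
by have := ler_norm (f 0%N); lra.
Qed.

(** The increment is max(f 0, - M') with M' >= 0. *)
Lemma max_walk_increment_abs (R : realType) (f : nat -> R) n :
  `|max_walk f n.+1 - max_walk (fun i => f i.+1) n| <= `|f 0%N|.
Proof.
rewrite max_walkS; have := max_walk_ge0 (fun i => f i.+1) n.
set M := max_walk _ _ => M0; rewrite ler_norml.
have := ler_norm (f 0%N); have := ler_norm (- f 0%N); rewrite normrN.
by case: (leP 0 (f 0%N + M)) => ? ? ?; apply/andP; split; lra.
Qed.

(** The increment is max(f 0, - M'), and M' eventually
    exceeds |f 0|. *)
Lemma max_walk_increment_escaping (R : realType) (f : nat -> R) :
  escaping f ->
  \forall n \near \oo, max_walk f n.+1 - max_walk (fun i => f i.+1) n = f 0%N.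
Proof.
move=> /(escaping_shift f).2 escf; have [m fm] := escf (Num.truncn `|f 0%N|).+1.
exists m => // n; rewrite /mkset => mn.
have : `|f 0%N| < max_walk (fun i => f i.+1) n.
  apply: lt_le_trans (max_walk_homo _ mn).
  by apply: lt_trans fm; exact: truncnS_gt.
have := ler_norm (- f 0%N); rewrite normrN.
rewrite max_walkS; set M := max_walk _ n.
by case: (leP 0 (f 0%N + M)) => ? ? ?; lra.
Qed.

Lemma not_escaping_bounded (R : realType) (f : nat -> R) :
  ~ escaping f -> exists K, forall n, \sum_(i < n) f i <= K.
Proof.
move=> /existsNP[K /forallNP fK]; exists K%:R => n.
apply: le_trans (sum_le_max_walk f n) _; rewrite leNgt; apply/negP; exact: fK.
Qed.

Lemma integrable_max_walk d (T : measurableType d) (R : realType)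
    (P : {measure set T -> \bar R}) (X : nat -> T -> R) (n : nat) :
  (forall i, P.-integrable setT (EFin \o X i)) ->
  P.-integrable setT (fun w => (max_walk (X^~ w) n)%:E).
Proof.
elim: n X => [|n IH] X iX; first exact: integrable0.
have iX' := IH (fun i => X i.+1) (fun i => iX i.+1).
have mX i : measurable_fun setT (X i).
  by apply/measurable_EFinP; exact: measurable_int (iX i).
apply: le_integrable (integrableD measurableT (iX 0%N) iX') => //.
  apply/measurable_EFinP.
  apply: (measurableT_comp (@measurable_max_walk R n.+1)).
  exact: measurable_to_seq_space.
move=> w _ /=; rewrite lee_fin ger0_norm ?le_max ?lexx//.
by rewrite ge_max normr_ge0 ler_norm.
Qed.

(** On the shift-invariant event A that the maxima escape, the
    integral of M_(n+1) - M'_n is nonnegative and tends to that of X_0, which is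
    P(A) E[X_0] because A depends on X_1, X_2, ... only. *)
Lemma negative_drift_bounded d (T : measurableType d) (R : realType)
    (P : probability T R) (X : nat -> T -> R) :
  iid P X -> P.-integrable setT (EFin \o X 0%N) ->
  (\int[P]_w (X 0%N w)%:E < 0)%E ->
  {ae P, forall w, exists K, forall n, \sum_(i < n) X i w <= K}.
Proof.
move=> iidX iX EX0; have [mX _ _] := iidX.
have iXn := iid_integrable iidX iX.
pose Xs w : seq_space R := fun i => X i w.
pose Xs' w : seq_space R := fun i => X i.+1 w.
have mXs : measurable_fun setT Xs by exact: measurable_to_seq_space.
have mXs' : measurable_fun setT Xs'.
  by apply: measurable_to_seq_space => i; exact: mX.
pose A := Xs' @^-1` @escaping R.
have AE : A = Xs @^-1` @escaping R.
  apply/seteqP; split=> w; first exact: (escaping_shift (Xs w)).1.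
  exact: (escaping_shift (Xs w)).2.
have mA : measurable A.
  by rewrite -[A]setTI; apply: mXs' => //; exact: measurable_escaping.
pose M n w := max_walk (Xs w) n.
pose M' n w := max_walk (Xs' w) n.
have iM n : P.-integrable A (EFin \o M n).
  by apply: (integrableS measurableT) => //; exact: integrable_max_walk.
have iM' n : P.-integrable A (EFin \o M' n).
  apply: (integrableS measurableT) => //.
  exact: (@integrable_max_walk _ _ _ _ (fun i => X i.+1)).
(* Both sequences have the same law, and A is the event that either of them
   is escaping. *)
have MM' n : (\int[P]_(w in A) (M' n w)%:E = \int[P]_(w in A) (M n w)%:E)%E.
  rewrite -[RHS]mul1e [in RHS]AE.
  apply: (@ge0_integral_eq_law _ _ _ _ _ _ Xs' Xs A (Xs @^-1` @escaping R)
    (1%:nng : {nonneg R}) (fun f => (max_walk f n)%:E)) => //.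
  - by rewrite -AE.
  - by apply/measurable_EFinP; exact: measurable_max_walk.
  - by move=> f; rewrite lee_fin max_walk_ge0.
  - move=> C mC; rewrite mul1e.
    apply: (iid_bump_law 0 iidX (B := C `&` @escaping R)).
    by apply: measurableI => //; exact: measurable_escaping.
pose g n w := M n.+1 w - M' n w.
have g_ge0 n : (0 <= \int[P]_(w in A) (g n w)%:E)%E.
  rewrite /g; under eq_integral do rewrite EFinB.
  rewrite (integralB mA (iM n.+1) (iM' n)) MM' subre_ge0; last first.
    exact: integrable_fin_num.
  apply: (le_integral mA (iM n) (iM n.+1)) => w _.
  by rewrite lee_fin max_walk_leS.
have g_cvg : (\int[P]_(w in A) (g n w)%:E @[n --> \oo]
              --> \int[P]_(w in A) (X 0%N w)%:E)%E.
  have mX0 : measurable_fun A (EFin \o X 0%N).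
    by apply/measurable_EFinP; exact: measurable_funTS.
  have := @dominated_convergence _ _ _ P A mA (fun n w => (g n w)%:E)
    (EFin \o X 0%N) (abse \o (EFin \o X 0%N)).
  case=> //.
  - move=> n; have := measurable_int _ (integrableB mA (iM n.+1) (iM' n)).
    by apply: eq_measurable_fun.
  - apply: aeW => w; rewrite AE => escw; apply: cvg_near_cst.
    near=> n; rewrite /= /g; congr _%:E.
    by near: n; exact: max_walk_increment_escaping.
  - by apply: integrable_abse; exact: integrableS iX.
  - apply: aeW => w n _ /=; rewrite lee_fin.
    exact: (max_walk_increment_abs (Xs w) n).
have : (0 <= \int[P]_(w in A) (X 0%N w)%:E)%E.
  rewrite -(cvg_lim _ g_cvg)//; apply: lime_ge; last exact: nearW.
  by apply/cvg_ex; eexists; exact: g_cvg.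
rewrite (integral_independent_event iX mA); last first.
  move=> C mC; apply: (iid_remove_one_independent 0 iidX mC).
  exact: measurable_escaping.
move=> PA; have {}PA : P A = 0%E.
  apply/eqP; rewrite eq_le measure_ge0 andbT leNgt; apply/negP => PA0.
  by move: PA; rewrite leNgt mule_gt0_lt0.
exists A; split => // w /= nb; rewrite AE; apply: contrapT.
by move=> /not_escaping_bounded; exact: nb.
Unshelve. all: end_near. Qed.

(** The sequence X - b has a negative drift. *)
Lemma iid_upper_average d (T : measurableType d) (R : realType)
    (P : probability T R) (X : nat -> T -> R) (b : R) :
  iid P X -> P.-integrable setT (EFin \o X 0%N) ->
  (\int[P]_w (X 0%N w)%:E < b%:E)%E ->
  {ae P, forall w, exists K : R, forall n, \sum_(i < n) X i w <= b * n%:R + K}.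
Proof.
move=> iidX iX EXb.
have mf : measurable_fun setT (fun x : R => x - b).
  by apply: measurable_funB => //; exact: measurable_cst.
have icst : P.-integrable setT (EFin \o (fun=> b)).
  exact: finite_measure_integrable_cst.
have iXb : P.-integrable setT (EFin \o (fun w => X 0%N w - b)).
  exact: (integrableB measurableT iX icst).
have EXb0 : (\int[P]_w (X 0%N w - b)%:E < 0)%E.
  under eq_integral do rewrite EFinB.
  rewrite (integralB_EFin measurableT iX icst).
  have Eb : (\int[P]_w b%:E)%E = b%:E.
    by have := expectation_cst P b; rewrite unlock.
  by rewrite Eb lteBlDr// add0e.
have [] := negative_drift_bounded (iid_comp mf iidX) iXb EXb0.
move=> N [mN N0 NK]; exists N; split=> // w /= nw; apply: NK => /= -[K SK].
apply: nw; exists K => n; have := SK n.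
by rewrite sumrB sumr_const card_ord lerBlDl mulr_natr.
Qed.

(** Kolmogorov's law: apply [iid_upper_average] to X and to - X, with
    bounds E[X_0] + 1/(k+1) and - E[X_0] + 1/(k+1) for every k. *)
Lemma strong_law d (T : measurableType d) (R : realType)
    (P : probability T R) (X : nat -> T -> R) :
  iid P X -> P.-integrable setT (EFin \o X 0%N) ->
  {ae P, forall w,
    (\sum_(i < n) X i w) / n%:R @[n --> \oo] --> fine (\int[P]_w (X 0%N w)%:E)}.
Proof.
move=> iidX iX; set m := fine _.
have mE : (\int[P]_w (X 0%N w)%:E)%E = m%:E.
  by rewrite fineK//; exact: integrable_fin_num.
have up (k : nat) : {ae P, forall w, exists K : R, forall n,
    \sum_(i < n) X i w <= (m + k.+1%:R^-1) * n%:R + K}.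
  by apply: iid_upper_average => //; rewrite mE lte_fin ltrDl.
have down (k : nat) : {ae P, forall w, exists K : R, forall n,
    \sum_(i < n) - X i w <= (- m + k.+1%:R^-1) * n%:R + K}.
  apply: (@iid_upper_average _ _ _ _ (fun n w => - X n w)) => //.
  - have mN : measurable_fun setT (fun x : R => - x) by exact: oppr_measurable.
    exact: (iid_comp mN iidX).
  - rewrite (_ : _ \o _ = -%E \o (EFin \o X 0%N))%E//; exact: integrableN.
  - under eq_integral do rewrite EFinN.
    by rewrite integralN ?mE ?lte_fin ?ltrDl// integrable_add_def.
have /ae_foralln := up; have /ae_foralln := down.
apply: filterS2 => w dw uw; apply/cvgrPdist_le => /= e e0.
pose k := Num.truncn (2 / e).
have ke : k.+1%:R^-1 <= e / 2.
  by rewrite -[leRHS]invf_div lef_pV2 ?posrE ?divr_gt0// ltW// truncnS_gt.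
have [K1 uK] := uw k; have [K2 dK] := dw k.
near=> n; have n0 : 0 < n%:R :> R by rewrite ltr0n; near: n; exists 1%N.
have nK1 : K1 <= e / 2 * n%:R.
  by rewrite mulrC -ler_pdivrMr ?divr_gt0//; near: n; exact: nbhs_infty_ger.
have nK2 : K2 <= e / 2 * n%:R.
  by rewrite mulrC -ler_pdivrMr ?divr_gt0//; near: n; exact: nbhs_infty_ger.
have := uK n; have := dK n; rewrite sumrN; set S := \sum_(i < n) _ => h1 h2.
have hk : k.+1%:R^-1 * n%:R <= e / 2 * n%:R by rewrite ler_wpM2r.
move: k.+1%:R^-1 n%:R n0 h1 h2 hk nK1 nK2 => u v v0 h1 h2 hk nK1 nK2.
rewrite distrC ler_norml; apply/andP; split.
  by rewrite lerBrDl ler_pdivlMr//; lra.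
by rewrite lerBlDl ler_pdivrMr//; lra.
Unshelve. all: end_near. Qed.

Lemma average_near (R : realType) (s : nat -> R) (c e : R) :
  s n / n%:R @[n --> \oo] --> c -> 0 < e ->
  \forall n \near \oo, `|s n - c * n%:R| <= e * n%:R.
Proof.
move=> sc e0; near=> n.
have n0 : 0 < n%:R :> R by rewrite ltr0n; near: n; exists 1%N.
have : `|c - s n / n%:R| <= e by near: n; exact: cvgr_dist_le.
have -> : c - s n / n%:R = - (s n - c * n%:R) / n%:R by field; rewrite gt_eqF.
by rewrite normrM normrN normfV (gtr0_norm n0) ler_pdivrMr.
Unshelve. all: end_near. Qed.

(** A term is the difference of two consecutive sums, both of which
    are c n + o(n). *)
Lemma average_term_near (R : realType) (x : nat -> R) (c e : R) :
  (\sum_(i < n) x i) / n%:R @[n --> \oo] --> c -> 0 < e ->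
  \forall n \near \oo, `|x n| <= e * n%:R.
Proof.
move=> xc e0; pose s n := \sum_(i < n) x i.
have e40 : 0 < e / 4 by rewrite divr_gt0.
have [N _ sN] := average_near xc e40; near=> n.
have Nn : (N <= n)%N by near: n; exact: nbhs_infty_ge.
have := sN n.+1 (leqW Nn); have := sN n Nn => /=.
rewrite big_ord_recr/= -/(s n) -[n.+1%:R]natr1.
have n0 : 1 <= n%:R :> R by rewrite ler1n; near: n; exists 1%N.
have nc : `|c| <= e / 4 * n%:R.
  by rewrite mulrC -ler_pdivrMr//; near: n; exact: nbhs_infty_ger.
move: nc; rewrite !ler_norml => /andP[c1 c2] /andP[h1 h2] /andP[h3 h4].
have : e / 4 <= e / 4 * n%:R by rewrite ler_peMr// ltW.
have -> : e * n%:R = 4 * (e / 4 * n%:R) by field.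
move: (e / 4) h1 h2 h3 h4 c1 c2 => r; rewrite !mulrDr !mulr1.
move: (r * n%:R) (c * n%:R) (s n) (x n) => rn cn sn xn *.
by apply/andP; split; lra.
Unshelve. all: end_near. Qed.

(** * Functionals of a cycle *)

(** An enumeration of a countable dense set of times, over which a
    right-continuous path has the same supremum as over all times. *)
Definition rational_time (R : realType) (k : nat) : {nonneg R} :=
  (`|ratr (odflt 0 (choice.unpickle k : option rat)) : R|)%:nng.

Lemma rational_time_dense (R : realType) (a b : R) : 0 <= a -> a < b ->
  exists k, a < (rational_time R k)%:num < b.
Proof.
move=> a0 /rat_in_itvoo[q]; rewrite in_itv/= => /andP[aq qb].
exists (choice.pickle q); rewrite /rational_time choice.pickleK /=.
rewrite ger0_norm ?aq ?qb//.
exact: ltW (le_lt_trans a0 aq).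
Qed.

(** The final value of a path that is eventually constant; the upper limit
    is measurable on the whole path space. *)
Definition path_end (R : realType) (z : R * path_space R) : R :=
  fine (limn_esup (fun k => (z.2 (k%:R)%:nng)%:E)).

Definition path_sup (R : realType) (z : R * path_space R) : \bar R :=
  ereal_sup (range (fun k => `|z.2 (rational_time R k)|%:E)).

Lemma measurable_path_coord (R : realType) (t : {nonneg R}) :
  measurable_fun setT (fun z : R * path_space R => (z.2 t : R)).
Proof.
apply: (measurableT_comp (f := fun f : path_space R => f t : R)
  _ (@measurable_snd _ _ _ _)).
move=> _ B mB; rewrite setTI; apply: sub_sigma_algebra.
by exists t, B.
Qed.

Lemma measurable_path_end (R : realType) : measurable_fun setT (@path_end R).
Proof.
apply: measurableT_comp; first exact: fine_measurable.
apply: measurable_fun_limn_esup => k.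
by apply/measurable_EFinP; exact: measurable_path_coord.
Qed.

Lemma measurable_path_sup (R : realType) : measurable_fun setT (@path_sup R).
Proof.
have := @measurable_fun_esups _ _ R setT
  (fun k (z : R * path_space R) => `|z.2 (rational_time R k)|%:E) _ 0%N.
rewrite (_ : (fun x => _) = @path_sup R); last first.
  apply/funext => z; rewrite /path_sup /esups /sdrop /=; congr ereal_sup.
  by apply/seteqP; split=> _ [k _ <-]; exists k.
apply=> k; apply/measurable_EFinP; apply: measurableT_comp => //.
exact: measurable_path_coord.
Qed.

Lemma path_sup_ge0 (R : realType) (z : R * path_space R) : (0 <= path_sup z)%E.
Proof.
apply: le_trans (ereal_sup_ubound _); last by exists 0%N.
by rewrite lee_fin.
Qed.

Lemma renewal_timeS (T : Type) (R : realType) (xi : nat -> T -> R) n w :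
  renewal_time xi n.+1 w = xi n w + renewal_time xi n w.
Proof. by rewrite /renewal_time big_ord_recr addrC. Qed.

Lemma renewal_time_ge0 (T : Type) (R : realType) (xi : nat -> T -> R) n w :
  (forall n w, 0 < xi n w) -> 0 <= renewal_time xi n w.
Proof. by move=> xi0; apply: sumr_ge0 => i _; exact: ltW. Qed.

Lemma path_end_increment (T : Type) (R : realType) (xi : nat -> T -> R)
    (Z : R -> T -> R) n w :
  path_end (increment xi Z n w) =
  value_at_renewal xi Z n.+1 w - value_at_renewal xi Z n w.
Proof.
rewrite /path_end; set u := (X in limn_esup X); set v := (RHS).
have uv : u @ \oo --> v%:E.
  apply: cvg_near_cst; near=> k; rewrite /u /v /increment /=.
  rewrite min_r; first by rewrite -renewal_timeS.
  by near: k; exact: nbhs_infty_ger.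
rewrite is_cvg_limn_esupE; last by apply/cvg_ex; exists v%:E.
by rewrite (cvg_lim _ uv).
Unshelve. all: end_near. Qed.

Lemma sum_path_end (T : Type) (R : realType) (xi : nat -> T -> R)
    (Z : R -> T -> R) n w : Z 0 w = 0 ->
  \sum_(i < n) path_end (increment xi Z i w) = value_at_renewal xi Z n w.
Proof.
move=> Z0; elim: n => [|n IH].
  by rewrite big_ord0 /value_at_renewal /renewal_time big_ord0 Z0.
by rewrite big_ord_recr /= IH path_end_increment addrC subrK.
Qed.

(** The form in which right-continuity allows a value of a path to
    be approached along rational times. *)
Lemma right_continuous_gt (R : realType) (f : R -> R) (t v c : R) :
  f s @[s --> t^'+] --> f t -> c < `|f t - v| ->
  exists2 e, 0 < e & forall u, t < u < t + e -> c < `|f u - v|.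
Proof.
move=> ft cft.
have : `|f s - v| @[s --> t^'+] --> `|f t - v|.
  by apply: cvg_norm; apply: cvgB => //; exact: cvg_cst.
move=> /cvgr_gt/(_ _ cft)/nbhs_ballP[e /= e0 te]; exists e => //.
move=> u /andP[tu ute].
apply: te => //; rewrite /ball/= distrC ltr_norml; apply/andP; split; lra.
Qed.

(** If the value at s exceeded the supremum over rational times, so
    would, by right-continuity, the values at rational times shortly after s.
    These must be smaller than xi n, after which the path is stopped; for
    s = xi n any later rational time has the same value. *)
Lemma path_sup_increment (T : Type) (R : realType) (xi : nat -> T -> R)
    (Z : R -> T -> R) n w s :
  (forall n w, 0 < xi n w) -> cadlag (Z^~ w) -> 0 <= s <= xi n w ->
  (`|Z (s + renewal_time xi n w) w - value_at_renewal xi Z n w|%:E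
   <= path_sup (increment xi Z n w))%E.
Proof.
move=> xi0 [rc _] /andP[s0 sxi]; set V := value_at_renewal xi Z n w.
set Tn := renewal_time xi n w.
have Tn0 : 0 <= Tn by exact: renewal_time_ge0.
set S := path_sup _; have S0 : (0 <= S)%E by exact: path_sup_ge0.
have SE k : (`|Z (Num.min (rational_time R k)%:num (xi n w) + Tn) w - V|%:E
    <= S)%E.
  by apply: ereal_sup_ubound; exists k.
move: S S0 SE => [c| |] // _ SE; last by rewrite leey.
rewrite lee_fin leNgt; apply/negP => cV.
have [e e0 eV] := right_continuous_gt (rc _ (addr_ge0 s0 Tn0)) cV.
have [xis|{}sxi] := leP (xi n w) s.
  have [k /andP[sk _]] := @rational_time_dense R s (s + 1) s0 (ltac:(lra)).
  have := SE k; rewrite min_r ?lee_fin ?(le_trans xis (ltW sk))//.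
  by rewrite (_ : xi n w = s) 1?leNgt ?cV//; apply/eqP; rewrite eq_le xis sxi.
have smin : s < Num.min (xi n w) (s + e) by rewrite lt_min sxi ltrDl.
have [k /andP[sk]] := rational_time_dense s0 smin.
rewrite lt_min => /andP[kxi ke].
have := SE k; rewrite min_l ?(ltW kxi)// lee_fin leNgt eV//.
by apply/andP; split; lra.
Qed.

(** Transfers the assumptions on M_1, a supremum over an
    uncountable set, to a measurable function of the first increment. *)
Lemma max_first_cycle_path_sup (T : Type) (R : realType) (xi : nat -> T -> R)
    (Z : R -> T -> R) w :
  (forall n w, 0 < xi n w) -> cadlag (Z^~ w) -> Z 0 w = 0 ->
  max_first_cycle xi Z w = path_sup (increment xi Z 0 w).
Proof.
move=> xi0 cZ Z0.
have T0 : renewal_time xi 0 w = 0 by rewrite /renewal_time big_ord0.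
have V0 : value_at_renewal xi Z 0 w = 0 by rewrite /value_at_renewal T0.
have T1 : renewal_time xi 1 w = xi 0%N w by rewrite /renewal_time big_ord1.
apply/eqP; rewrite eq_le; apply/andP; split.
  apply: ge_ereal_sup => _ [t + <-]; rewrite /= in_itv/= T1 => t01.
  by have := path_sup_increment xi0 cZ t01; rewrite T0 V0 addr0 subr0.
apply: ge_ereal_sup => _ [k _ <-]; apply: ereal_sup_ubound.
exists (Num.min (rational_time R k)%:num (xi 0%N w)) => /=.
  rewrite in_itv/= T1 ge_min lexx orbT andbT le_min normr_ge0.
  exact: ltW (xi0 _ _).
by rewrite T0 V0 addr0 subr0.
Qed.

Definition path_centered (R : realType) (a : R) (z : R * path_space R) : R :=
  path_end z - a * z.1.

(** A bound for the variation of Z(t) - a t inside a cycle. *)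
Definition path_deviation (R : realType) (a : R) (z : R * path_space R)
    : \bar R :=
  (path_sup z + (`|a| * z.1)%:E)%E.

Lemma measurable_path_centered (R : realType) (a : R) :
  measurable_fun setT (@path_centered R a).
Proof.
apply: measurable_funB; first exact: measurable_path_end.
by apply: measurable_funM => //; exact: measurable_fst.
Qed.

Lemma measurable_path_deviation (R : realType) (a : R) :
  measurable_fun setT (@path_deviation R a).
Proof.
apply: emeasurable_funD; first exact: measurable_path_sup.
by apply/measurable_EFinP; apply: measurable_funM => //; exact: measurable_fst.
Qed.

Lemma measurable_large_deviation (R : realType) (a : R) (K : nat) :
  measurable [set e | (K%:R%:E < path_deviation a e)%E].
Proof.
rewrite (_ : [set e | _] = setT `&` @path_deviation R a @^-1` `]K%:R%:E, +oo[).
  by apply: measurable_path_deviation => //; exact: emeasurable_itv.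
by rewrite setTI; apply/seteqP; split=> e /=; rewrite in_itv/= andbT.
Qed.

(** With V the value of Z at the start T_n of the cycle,
    Z(t) - a t = (V - a T_n) + (Z(t) - V) - a (t - T_n), and the first term is
    the sum of the centered increments. *)
Lemma centered_process_bound (T : Type) (R : realType) (xi : nat -> T -> R)
    (Z : R -> T -> R) (a : R) n w t :
  (forall n w, 0 < xi n w) -> cadlag (Z^~ w) -> Z 0 w = 0 ->
  renewal_time xi n w <= t < renewal_time xi n.+1 w ->
  (`|Z t w - a * t|%:E <=
     `|\sum_(i < n) path_centered a (increment xi Z i w)|%:E
     + path_deviation a (increment xi Z n w))%E.
Proof.
move=> xi0 cZ Z0; rewrite renewal_timeS => /andP[Tnt tTn].
rewrite /path_centered sumrB sum_path_end// -mulr_sumr.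
have -> : \sum_(i < n) (increment xi Z i w).1 = renewal_time xi n w by [].
set Tn := renewal_time xi n w in Tnt tTn *; set V := value_at_renewal xi Z n w.
have txi : 0 <= t - Tn <= xi n w by apply/andP; split; lra.
have := path_sup_increment xi0 cZ txi; rewrite -/Tn -/V subrK => ZV.
rewrite /path_deviation addeCA.
apply: (@le_trans _ _ (`|Z t w - V|%:E + (`|V - a * Tn| + `|a| * xi n w)%:E)%E).
  rewrite -EFinD lee_fin.
  have -> : Z t w - a * t = (Z t w - V) + ((V - a * Tn) - a * (t - Tn)) by ring.
  apply: le_trans (ler_normD _ _) _; rewrite lerD2l.
  apply: le_trans (ler_normB _ _) _; rewrite lerD2l normrM ler_wpM2l//.
  by case/andP: txi => t0 t1; rewrite ger0_norm.
by rewrite EFinD leeD2r.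
Qed.

(** * The cycle that covers a given time *)

(** Renewal times of a sequence of marks z with cycle lengths l (z n); keeping
    the marks allows to speak of independence from the whole cycle and not only
    from its length. *)
Definition epoch (T E : Type) (R : realType) (z : nat -> T -> E) (l : E -> R)
  (n : nat) (w : T) : R := \sum_(i < n) l (z i w).

Lemma epochS (T E : Type) (R : realType) (z : nat -> T -> E) (l : E -> R) n w :
  epoch z l n.+1 w = epoch z l n w + l (z n w).
Proof. by rewrite /epoch big_ord_recr. Qed.

Lemma epoch_nondecreasing (T E : Type) (R : realType) (z : nat -> T -> E)
    (l : E -> R) w : (forall n, 0 <= l (z n w)) ->
  {homo (epoch z l)^~ w : m n / (m <= n)%N >-> m <= n}.
Proof.
move=> l0; apply: homo_leq => [//||n]; first exact: le_trans.
by rewrite epochS lerDl.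
Qed.

Lemma measurable_epoch d d' (T : measurableType d) (E : measurableType d')
    (R : realType) (z : nat -> T -> E) (l : E -> R) n :
  (forall n, measurable_fun setT (z n)) -> measurable_fun setT l ->
  measurable_fun setT (epoch z l n).
Proof.
move=> mz ml; elim: n => [|n IH].
  rewrite (_ : epoch z l 0 = cst 0)//.
  by apply/funext => w; rewrite /epoch big_ord0.
rewrite (_ : epoch z l n.+1 = epoch z l n \+ (l \o z n)).
  by apply: measurable_funD => //; exact: measurableT_comp.
by apply/funext => w; rewrite epochS.
Qed.

(** The n-th epoch depends on the marks before z n only. *)
Lemma epoch_independent_present d d' (T : measurableType d)
    (E : measurableType d') (R : realType) (P : probability T R)
    (z : nat -> T -> E) (l : E -> R) (n : nat) (C : set E) (I : set R) :
  iid P z -> measurable_fun setT l -> measurable C -> measurable I ->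
  P ((z n @^-1` C) `&` (epoch z l n @^-1` I)) =
  (P (z 0%N @^-1` C) * P (epoch z l n @^-1` I))%E.
Proof.
move=> iidz ml mC mI; have [_ _ idz] := iidz.
pose B : set (seq_space E) := [set f | I (\sum_(i < n) l (f i))].
have mB : measurable B.
  rewrite -[B]setTI; have := @measurable_epoch _ _ (seq_space E) E R
    (fun i f => f i) l n (@measurable_coord _ E) ml.
  exact.
have := iid_remove_one_independent n iidz mC mB.
rewrite (_ : [set w | B _] = epoch z l n @^-1` I); last first.
  apply/seteqP; split=> w; rewrite /B/= /epoch.
    by under eq_bigr => i _ do rewrite /bump leqNgt ltn_ord add0n.
  by under [X in _ -> I X]eq_bigr => i _ do rewrite /bump leqNgt ltn_ord add0n.
by rewrite (idz n 0%N).
Qed.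

(** The events that the n-th epoch lies in the window and is
    followed by a cycle of length at least c are disjoint: such an epoch is the
    last one in the window.  By independence their probabilities are the terms
    of the left-hand side. *)
Lemma renewal_window_bound d d' (T : measurableType d)
    (E : measurableType d') (R : realType) (P : probability T R)
    (z : nat -> T -> E) (l : E -> R) (c x : R) :
  iid P z -> measurable_fun setT l -> (forall n w, 0 <= l (z n w)) ->
  (P [set w | (c <= l (z 0%N w))%R] *
   \sum_(0 <= n <oo) P (epoch z l n @^-1` `]x, (x + c)%R]) <= 1)%E.
Proof.
move=> iidz ml l0; have [mz _ _] := iidz.
have mC : measurable [set e | c <= l e].
  rewrite (_ : [set e | _] = setT `&` l @^-1` `[c, +oo[%classic).
    exact: ml.
  by rewrite setTI; apply/seteqP; split=> e /=; rewrite in_itv/= andbT.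
pose F n := (z n @^-1` [set e | c <= l e]) `&`
  (epoch z l n @^-1` `]x, (x + c)]).
have mF n : measurable (F n).
  apply: measurableI; rewrite -[X in measurable X]setTI; first exact: mz.
  exact: measurable_epoch.
have tF : trivIset setT F.
  apply: ltn_trivIset => m n mn.
  apply/seteqP; split=> // w [[/= cm]]; rewrite in_itv/= => /andP[xm _] [_ /=].
  rewrite in_itv/= => /andP[_]; rewrite leNgt => /negP; apply.
  apply: lt_le_trans (epoch_nondecreasing (l0^~ w) mn).
  by rewrite epochS; lra.
have -> : P [set w | c <= l (z 0%N w)] =
    (fine (P (z 0%N @^-1` [set e | c <= l e])))%:E.
  rewrite fineK ?fin_num_measure// -[X in measurable X]setTI; exact: mz.
rewrite -nneseriesZl//.
apply: (@le_trans _ _ (\sum_(0 <= n <oo) P (F n))%E).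
  apply: lee_nneseries => n _.
    by rewrite mule_ge0// lee_fin fine_ge0.
  rewrite fineK ?fin_num_measure//; last first.
    by rewrite -[X in measurable X]setTI; exact: mz.
  by rewrite /F epoch_independent_present.
rewrite -measure_semi_bigcup//; last exact: bigcup_measurable.
by apply: probability_le1; exact: bigcup_measurable.
Qed.

Lemma measurable_covering_event d d' (T : measurableType d)
    (E : measurableType d') (R : realType) (z : nat -> T -> E) (l : E -> R)
    (B : set E) (t : R) :
  (forall n, measurable_fun setT (z n)) -> measurable_fun setT l ->
  measurable B ->
  measurable [set w | exists n,
    (epoch z l n w <= t < epoch z l n.+1 w) /\ B (z n w)].
Proof.
move=> mz ml mB.
rewrite (_ : [set w | _] = \bigcup_n ((z n @^-1` B) `&`
    ((epoch z l n @^-1` `]-oo, t]) `&` (epoch z l n.+1 @^-1` `]t, +oo[)))).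
  apply: bigcupT_measurable => n; apply: measurableI; last apply: measurableI;
    rewrite -[X in measurable X]setTI.
  - exact: mz.
  - exact: measurable_epoch.
  - exact: measurable_epoch.
apply/seteqP; split=> w.
  by move=> [n [/andP[? ?] ?]]; exists n => //=; rewrite !in_itv/= andbT.
move=> [n _ [Bn [/=]]]; rewrite !in_itv/= andbT => nt tn; exists n.
by rewrite nt tn.
Qed.

(** If the n-th cycle covers t and starts at a distance in
    [k c, (k+1) c) before t, then its length exceeds k c.  By independence, the
    sum over n of the probabilities for fixed k is the product of
    P(z_0 in B, l z_0 > k c) and an expected number of epochs in a window of
    length c. *)
Lemma covering_cycle_bound d d' (T : measurableType d)
    (E : measurableType d') (R : realType) (P : probability T R)
    (z : nat -> T -> E) (l : E -> R) (B : set E) (c t : R) :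
  0 < c -> iid P z -> measurable_fun setT l -> (forall n w, 0 <= l (z n w)) ->
  measurable B ->
  (P [set w | (c <= l (z 0%N w))%R] *
   P [set w | exists n, (epoch z l n w <= t < epoch z l n.+1 w)%R /\ B (z n w)]
   <= \sum_(0 <= k <oo)
        P (z 0%N @^-1` (B `&` [set e | (k%:R * c < l e)%R])))%E.
Proof.
move=> c0 iidz ml l0 mB; have [mz _ _] := iidz.
have mBk k : measurable (B `&` [set e | k%:R * c < l e]).
  apply: measurableI => //.
  rewrite (_ : [set e | _] = setT `&` l @^-1` `]k%:R * c, +oo[%classic).
    exact: ml.
  by rewrite setTI; apply/seteqP; split=> e /=; rewrite in_itv/= andbT.
(* The left end of the k-th window of length c, counted backwards from t. *)
pose x (k : nat) := t - (k.+1%:R * c).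
pose G n k := (z n @^-1` (B `&` [set e | k%:R * c < l e])) `&`
  (epoch z l n @^-1` `](x k), (x k + c)]).
have mG n k : measurable (G n k).
  apply: measurableI; rewrite -[X in measurable X]setTI; first exact: mz.
  exact: measurable_epoch.
set p := P [set w | _]; set Et := [set w | exists n, _].
pose r k := P (z 0%N @^-1` (B `&` [set e | k%:R * c < l e])).
pose q n k := P (epoch z l n @^-1` `](x k), (x k + c)]).
have EtE : Et `<=` \bigcup_n \bigcup_k G n k.
  move=> w [n [/andP[nt tn] Bn]]; exists n => //.
  have tc : 0 <= (t - epoch z l n w) / c.
    by apply: divr_ge0; [rewrite subr_ge0|exact: ltW].
  have /andP[kl ku] := Num.Theory.truncn_itv tc.
  move: (Num.truncn _) kl ku => k; rewrite ler_pdivlMr// ltr_pdivrMr// => kl ku.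
  exists k => //; rewrite /G /x /= in_itv/=.
  move: ku; rewrite -natr1 mulrDl mul1r => ku; split; first split => //.
    by move: tn; rewrite epochS; lra.
  by apply/andP; split; lra.
have mEt : measurable Et by exact: measurable_covering_event.
have q_ge0 n k : (0 <= q n k)%E by [].
have r_ge0 k : (0 <= r k)%E by [].
have rE k : r k = (fine (r k))%:E.
  by rewrite fineK ?fin_num_measure// -[X in measurable X]setTI; exact: mz.
have pE : p = (fine p)%:E.
  rewrite fineK ?fin_num_measure//.
  rewrite (_ : [set w | _] = (l \o z 0%N) @^-1` `[c, +oo[%classic).
    by rewrite -[X in measurable X]setTI; exact: measurableT_comp.
  by apply/seteqP; split=> w /=; rewrite in_itv/= andbT.
have Et_le : (P Et <= \sum_(0 <= k <oo) r k * \sum_(0 <= n <oo) q n k)%E.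
  apply: (@le_trans _ _ (\sum_(0 <= n <oo) P (\bigcup_k G n k))%E).
    apply: measure_sigma_subadditive => // n; exact: bigcupT_measurable.
  apply: (@le_trans _ _ (\sum_(0 <= n <oo) \sum_(0 <= k <oo) r k * q n k)%E).
    apply: lee_nneseries => // n _.
    apply: (@le_trans _ _ (\sum_(0 <= k <oo) P (G n k))%E).
      by apply: measure_sigma_subadditive => //; exact: bigcupT_measurable.
    apply: lee_nneseries => // k _.
    by rewrite /G epoch_independent_present.
  rewrite nneseries_interchange; last by move=> n k; exact: mule_ge0.
  apply: lee_nneseries => [k _ _|k _].
    by apply: nneseries_ge0 => n _ _; exact: mule_ge0.
  by rewrite rE nneseriesZl.
have p_ge0 : (0 <= p)%E by rewrite /p.
apply: le_trans (lee_wpmul2l p_ge0 Et_le) _.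
rewrite pE -nneseriesZl; last first.
  by move=> k _; rewrite mule_ge0// nneseries_ge0.
apply: lee_nneseries => [k _ _|k _].
  by rewrite !mule_ge0// ?lee_fin ?fine_ge0// nneseries_ge0.
rewrite muleCA -[leRHS]mule1 lee_wpmul2l// -pE.
exact: renewal_window_bound.
Qed.

Lemma sum_tail_indicators_le (R : realType) (c x : R) (m : nat) :
  0 < c -> 0 <= x -> \sum_(k < m) ((k%:R * c < x)%R%:R : R) <= x / c + 1.
Proof.
move=> c0 x0; elim: m => [|m IH].
  by rewrite big_ord0 addr_ge0// divr_ge0// ltW.
rewrite big_ord_recr/=; case: ltP => [mx|_]; last by rewrite addr0.
rewrite lerD2r; apply: (@le_trans _ _ m%:R).
  rewrite -[X in _ <= X%:R]card_ord -sumr_const; apply: ler_sum => k _.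
  by rewrite lern1 leq_b1.
by rewrite ler_pdivlMr// ltW.
Qed.

(** There are at most X/c + 1 integers k >= 0 with k c < X. *)
Lemma sum_tail_prob_le d (T : measurableType d) (R : realType)
    (P : probability T R) (X : T -> R) (A : set T) (c : R) :
  0 < c -> measurable_fun setT X -> (forall w, 0 <= X w) -> measurable A ->
  (\sum_(0 <= k <oo) P (A `&` [set w | (k%:R * c < X w)%R])
   <= \int[P]_(w in A) (X w / c + 1)%:E)%E.
Proof.
move=> c0 mX X0 mA.
have mk k : measurable [set w | k%:R * c < X w].
  rewrite (_ : [set w | _] = setT `&` X @^-1` `]k%:R * c, +oo[%classic).
    exact: mX.
  by rewrite setTI; apply/seteqP; split=> w /=; rewrite in_itv/= andbT.
under eq_eseriesr => k _ do rewrite setIC -integral_indic//.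
rewrite -integral_nneseries//; last first.
  move=> k; apply/measurable_EFinP; exact: measurable_indic.
apply: ge0_le_integral => //.
- by move=> w _; apply: nneseries_ge0.
- apply: (@ge0_emeasurable_sum _ _ _ _ _ xpredT) => // k _.
  apply/measurable_EFinP; exact: measurable_indic.
- apply/measurable_EFinP; apply: measurable_funD => //.
  by apply: measurable_funM => //; exact: measurable_funTS.
move=> w _; apply: lime_le; first exact: is_cvg_nneseries.
apply: nearW => m; rewrite sumEFin lee_fin big_mkord.
apply: le_trans (sum_tail_indicators_le m c0 (X0 w)).
by apply: ler_sum => k _; rewrite indicE mem_setE.
Qed.

(** The cycle covering x is found by minimality of the first t k > x. *)
Lemma renewal_index (R : realType) (t : nat -> R) (x : R) (m k : nat) :
  {homo t : i j / (i <= j)%N >-> i <= j} -> t m <= x -> x < t k ->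
  exists2 n, (m <= n)%N & t n <= x < t n.+1.
Proof.
move=> ht mx kx; have ex : exists k, x < t k by exists k.
case: (ex_minnP ex) => j xj jmin.
have mj : (m < j)%N.
  rewrite ltnNge; apply/negP => /ht jm.
  by have := le_lt_trans (le_trans jm mx) xj; rewrite ltxx.
have jE : j = j.-1.+1 by rewrite prednK// (leq_ltn_trans _ mj).
exists j.-1; first by rewrite -ltnS -jE.
rewrite -jE xj andbT leNgt; apply/negP => /jmin.
by rewrite jE ltnn.
Qed.

(** * The two laws for regenerative increments *)

(** The constant a is chosen to make the centered increments
    have mean zero. *)
Lemma centered_sum_average d (T : measurableType d) (R : realType)
    (P : probability T R) (xi : nat -> T -> R) (Z : R -> T -> R) :
  (forall n w, 0 < xi n w) -> regenerative_increments P xi Z ->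
  P.-integrable setT (EFin \o xi 0%N) ->
  P.-integrable setT (EFin \o value_at_renewal xi Z 1) ->
  let mu := fine (\int[P]_w (xi 0%N w)%:E) in
  let a := fine (\int[P]_w (value_at_renewal xi Z 1 w)%:E) / mu in
  {ae P, forall w,
    (\sum_(i < n) path_centered a (increment xi Z i w)) / n%:R
      @[n --> \oo] --> (0 : R)}.
Proof.
move=> xi0 [Z0 iidz] ixi iV mu a.
have mu0 : 0 < mu by apply: mean_gt0.
have cE w : path_centered a (increment xi Z 0 w) =
    value_at_renewal xi Z 1 w - a * xi 0%N w.
  rewrite /path_centered path_end_increment.
  rewrite [X in _ - X - _](_ : _ = 0) ?subr0//.
  by rewrite /value_at_renewal /renewal_time big_ord0.
have iaxi : P.-integrable setT (EFin \o (fun w => a * xi 0%N w)).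
  exact: (integrableZl measurableT a ixi).
have ic : P.-integrable setT
    (EFin \o (fun w => path_centered a (increment xi Z 0 w))).
  rewrite (_ : _ \o _ =
    EFin \o (fun w => value_at_renewal xi Z 1 w - a * xi 0%N w)).
    exact: (integrableB measurableT iV iaxi).
  by apply/funext => w /=; rewrite cE.
have := strong_law (iid_comp (measurable_path_centered a) iidz) ic.
suff -> : fine (\int[P]_w (path_centered a (increment xi Z 0 w))%:E) = 0 by [].
under eq_integral do rewrite cE EFinB.
rewrite (integralB_EFin measurableT iV iaxi).
under [X in (_ - X)%E]eq_integral do rewrite EFinM.
rewrite integralZl// fineB ?fineM ?integrable_fin_num//.
  by rewrite /a /= divfK ?subrr// gt_eqF.
by rewrite fin_numM// integrable_fin_num.
Qed.

(** Half the mean is a rate that the renewal times eventually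
    exceed; it serves to bound the number of cycles before t by a multiple
    of t. *)
Lemma renewal_time_near d (T : measurableType d) (R : realType)
    (P : probability T R) (xi : nat -> T -> R) :
  renewal_process P xi -> P.-integrable setT (EFin \o xi 0%N) ->
  let mu := fine (\int[P]_w (xi 0%N w)%:E) in
  {ae P, forall w, \forall n \near \oo, mu / 2 * n%:R <= renewal_time xi n w}.
Proof.
move=> [iidxi xi0] ixi mu.
have mu0 : 0 < mu by apply: mean_gt0.
have := strong_law iidxi ixi; apply: filterS => w cw.
have := average_near cw (divr_gt0 mu0 (ltr0Sn _ 1)); apply: filterS => n.
rewrite ler_norml /renewal_time -/mu => /andP[h _]; rewrite -subr_ge0.
move: h; rewrite -subr_ge0; lra.
Qed.

(** The part of the argument common to both laws, for a single path:
    once the sums and the renewal times have the right size, only the deviation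
    of the covering cycle remains to be controlled. *)
Lemma regenerative_bound (T : Type) (R : realType) (xi : nat -> T -> R)
    (Z : R -> T -> R) (a nu e t : R) (m : nat) w :
  (forall n w, 0 < xi n w) -> cadlag (Z^~ w) -> Z 0 w = 0 ->
  0 < nu -> 0 <= e ->
  (forall n, (m <= n)%N ->
     `|\sum_(i < n) path_centered a (increment xi Z i w)| <= e * n%:R) ->
  (forall n, (m <= n)%N -> nu * n%:R <= renewal_time xi n w) ->
  renewal_time xi m w <= t ->
  exists n, [/\ (m <= n)%N, renewal_time xi n w <= t < renewal_time xi n.+1 w,
    n%:R <= t / nu &
    (`|Z t w - a * t|%:E <=
      (e * (t / nu))%:E + path_deviation a (increment xi Z n w))%E].
Proof.
move=> xi0 cZ Z0 nu0 e0 Se Tnu Tt.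
have hT : {homo (renewal_time xi)^~ w : i j / (i <= j)%N >-> i <= j}.
  exact: (@epoch_nondecreasing _ _ _ xi id w (fun n => ltW (xi0 n w))).
pose k := (maxn m (Num.truncn (t / nu)).+1).
have tk : t < renewal_time xi k w.
  apply: lt_le_trans (Tnu k (leq_maxl _ _)).
  rewrite mulrC -ltr_pdivrMr//; apply: lt_le_trans (truncnS_gt _) _.
  by rewrite ler_nat leq_maxr.
have [n mn /andP[nt tn]] := renewal_index hT Tt tk.
have nnu : n%:R <= t / nu.
  by rewrite ler_pdivlMr// mulrC; exact: le_trans (Tnu n mn) nt.
exists n; split => //; first by rewrite nt.
apply: le_trans (centered_process_bound a xi0 cZ Z0 _) _.
  by apply/andP; split; [exact: nt|exact: tn].
rewrite leeD2r// lee_fin; apply: le_trans (Se n mn) _.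
by rewrite ler_wpM2l.
Qed.

Lemma deviation_integrable d (T : measurableType d) (R : realType)
    (P : probability T R) (xi : nat -> T -> R) (Z : R -> T -> R) (a : R) :
  renewal_process P xi -> (forall w, cadlag (Z^~ w)) ->
  regenerative_increments P xi Z -> P.-integrable setT (EFin \o xi 0%N) ->
  (\int[P]_w max_first_cycle xi Z w < +oo)%E ->
  P.-integrable setT (fun w => path_deviation a (increment xi Z 0 w)).
Proof.
move=> [_ xi0] cZ [Z0 [minc _ _]] ixi M1oo.
apply: (@integrableD _ _ _ P setT measurableT
  (fun w => path_sup (increment xi Z 0 w))
  (fun w => (`|a| * xi 0%N w)%:E)); last first.
  exact: (integrableZl measurableT `|a| ixi).
apply/integrableP; split.
  exact: (measurableT_comp (@measurable_path_sup R) (minc 0%N)).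
apply: le_lt_trans M1oo; rewrite le_eqVlt; apply/orP; left; apply/eqP.
apply: eq_integral => w _; rewrite max_first_cycle_path_sup//.
by rewrite gee0_abs// path_sup_ge0.
Qed.

(** The deviations of the cycles have converging averages by the
    strong law, so the deviation of the n-th cycle is o(n). *)
Lemma regenerative_strong_law d (T : measurableType d) (R : realType)
    (P : probability T R) (xi : nat -> T -> R) (Z : R -> T -> R) :
  renewal_process P xi -> (forall w, cadlag (Z^~ w)) ->
  regenerative_increments P xi Z -> P.-integrable setT (EFin \o xi 0%N) ->
  P.-integrable setT (EFin \o value_at_renewal xi Z 1) ->
  (\int[P]_w max_first_cycle xi Z w < +oo)%E ->
  let mu := fine (\int[P]_w (xi 0%N w)%:E) in
  let a := fine (\int[P]_w (value_at_renewal xi Z 1 w)%:E) / mu in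
  {ae P, forall w, Z t w / t @[t --> +oo] --> a}.
Proof.
move=> hxi cZ hreg ixi iV M1oo mu a; have [iidxi xi0] := hxi.
have [Z0 iidz] := hreg; have [minc _ idz] := iidz.
have mu0 : 0 < mu by apply: mean_gt0.
have idev := deviation_integrable a hxi cZ hreg ixi M1oo.
pose dev n w := path_deviation a (increment xi Z n w).
have idevn n : P.-integrable setT (dev n).
  have law C : measurable C ->
      P (increment xi Z n @^-1` C) = P (increment xi Z 0 @^-1` C).
    by move=> mC; exact: idz.
  exact: (integrable_eq_law (minc n) (minc 0%N)
    (measurable_path_deviation a) law idev).
have dev_fin : {ae P, forall w n, dev n w \is a fin_num}.
  apply/ae_foralln => n; have := integrable_ae measurableT (idevn n).
  by apply: filterS => w; exact.
have mfdev : measurable_fun setT (fine \o @path_deviation R a).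
  exact: (measurableT_comp (fine_measurable measurableT)
    (measurable_path_deviation a)).
have ifdev : P.-integrable setT (EFin \o (fun w => fine (dev 0%N w))).
  apply: (le_integrable measurableT _ _ (idevn 0%N)).
    by apply/measurable_EFinP; exact: (measurableT_comp mfdev (minc 0%N)).
  by move=> w _ /=; case: (dev 0%N w) => [r| |] //=; rewrite normr0 leey.
have avg_dev := strong_law (iid_comp mfdev iidz) ifdev.
have avg_c := centered_sum_average xi0 hreg ixi iV.
have Tn := renewal_time_near hxi ixi.
apply: filterS3 avg_dev avg_c (filterI dev_fin Tn) => w dw cw [dfin Tw].
apply/cvgrPdist_le => /= e e0.
pose nu := mu / 2; have nu0 : 0 < nu by rewrite divr_gt0.
(* Sum and deviation contribute e' n each, and n <= t / nu. *)
pose e' := e * nu / 2; have e'0 : 0 < e' by rewrite !mulr_gt0 ?invr_gt0.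
have [m1 _ Sm] := average_near cw e'0.
have [m2 _ Dm] := @average_term_near _ (fun n => fine (dev n w)) _ _ dw e'0.
have [m3 _ Tm] := Tw.
pose m := maxn m1 (maxn m2 m3).
have Sm' n : (m <= n)%N ->
    `|\sum_(i < n) path_centered a (increment xi Z i w)| <= e' * n%:R.
  rewrite !geq_max => /andP[h _]; have := Sm n h => /=.
  by rewrite mul0r subr0.
have Tm' n : (m <= n)%N -> nu * n%:R <= renewal_time xi n w.
  by rewrite !geq_max => /and3P[_ _ h]; exact: Tm.
have Dm' n : (m <= n)%N -> `|fine (dev n w)| <= e' * n%:R.
  by rewrite !geq_max => /and3P[_ h _]; exact: Dm.
near=> t.
have t0 : 0 < t by near: t; apply: nbhs_pinfty_gt; rewrite num_real.
have Tt : renewal_time xi m w <= t.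
  by near: t; apply: nbhs_pinfty_ge; rewrite num_real.
have [n [mn _ nt]] :=
  regenerative_bound xi0 (cZ w) (Z0 w) nu0 (ltW e'0) Sm' Tm' Tt.
rewrite -/(dev n w) -(fineK (dfin n)) -EFinD lee_fin => Zt.
have -> : a - Z t w / t = - (Z t w - a * t) / t by field; rewrite gt_eqF.
rewrite normrM normrN normfV (gtr0_norm t0) ler_pdivrMr//.
apply: (le_trans Zt); have := Dm' n mn; rewrite ler_norml => /andP[_ Dn].
have : e' * n%:R <= e' * (t / nu) by rewrite ler_wpM2l// ltW.
have -> : e * t = e' * (t / nu) + e' * (t / nu).
  by rewrite /e'; field; rewrite gt_eqF.
by move=> ?; rewrite lerD2l; exact: le_trans Dn _.
Unshelve. all: end_near. Qed.

(** The deviation of the cycle that covers t is tight, uniformly in t: the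
    bound of [covering_cycle_bound], with B the event of a deviation above K,
    is free of t and vanishes as K grows. *)
Lemma covering_deviation_small d (T : measurableType d) (R : realType)
    (P : probability T R) (xi : nat -> T -> R) (Z : R -> T -> R) (a e : R) :
  renewal_process P xi -> (forall w, cadlag (Z^~ w)) ->
  regenerative_increments P xi Z -> P.-integrable setT (EFin \o xi 0%N) ->
  {ae P, forall w, (max_first_cycle xi Z w < +oo)%E} -> 0 < e ->
  exists K : nat, forall t, (P [set w | exists n,
    (renewal_time xi n w <= t < renewal_time xi n.+1 w)%R /\
    (K%:R%:E < path_deviation a (increment xi Z n w))%E] <= e%:E)%E.
Proof.
move=> [_ xi0] cZ [Z0 iidz] ixi M1oo e0; have [minc _ _] := iidz.
have mxi : measurable_fun setT (xi 0%N).
  by apply/measurable_EFinP; exact: measurable_int ixi.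
have [c c0 Pc] := positive_bounded_below P mxi (xi0 0%N).
pose F K := increment xi Z 0 @^-1` [set e | (K%:R%:E < path_deviation a e)%E].
have mF K : measurable (F K).
  rewrite -[F K]setTI; apply: minc => //; exact: measurable_large_deviation.
have ig : P.-integrable setT (EFin \o (fun w => xi 0%N w / c + 1)).
  have ixic : P.-integrable setT (EFin \o (fun w => xi 0%N w / c)).
    rewrite (_ : _ \o _ = (fun w => c^-1%:E * (EFin \o xi 0%N) w)%E).
      exact: integrableZl.
    by apply/funext => w; rewrite /= -EFinM mulrC.
  have i1 : P.-integrable setT (EFin \o cst (1 : R)).
    exact: finite_measure_integrable_cst.
  exact: (integrableD measurableT ixic i1).
have e20 : 0 < e / 2 by rewrite divr_gt0.
have Fev : {ae P, forall w, \forall K \near \oo, ~ F K w}.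
  apply: filterS M1oo => w; rewrite max_first_cycle_path_sup// => supoo.
  have [r rE] : exists r, path_deviation a (increment xi Z 0 w) = r%:E.
    rewrite /path_deviation; have := path_sup_ge0 (increment xi Z 0 w).
    by case: (path_sup _) supoo => // s _ _; eexists.
  near=> K; rewrite /F /= rE lte_fin; apply/negP; rewrite -leNgt.
  by near: K; exact: nbhs_infty_ger.
have [K FK] := integral_vanishing mF ig e20 Fev; exists K => t.
have := covering_cycle_bound t c0 iidz (@measurable_fst _ _ _ _)
  (fun n w => ltW (xi0 n w)) (measurable_large_deviation a K).
set p := P [set w | _]; set Et := [set w | exists n, _] => Ebound.
have {}Ebound : (p * P Et <= (e / 2)%:E)%E.
  apply: (le_trans Ebound); apply: le_trans FK.
  exact: (sum_tail_prob_le P c0 mxi (fun w => ltW (xi0 0%N w)) (mF K)).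
have : ((2^-1)%:E * P Et <= (e / 2)%:E)%E.
  by apply: le_trans Ebound; rewrite lee_wpmul2r.
by rewrite lee_pdivrMl// -EFinM mulrC divfK.
Unshelve. all: end_near. Qed.

(** The event that Z(t)/t is at distance at least e from a is
    contained in the union of three events of small probability: an estimate
    for the sums or the renewal times fails at a rank n >= m, the m-th renewal
    time is large, or the deviation of the cycle covering t exceeds K. *)
Lemma regenerative_weak_law d (T : measurableType d) (R : realType)
    (P : probability T R) (xi : nat -> T -> R) (Z : R -> T -> R) :
  renewal_process P xi -> cadlag_process Z ->
  regenerative_increments P xi Z -> P.-integrable setT (EFin \o xi 0%N) ->
  P.-integrable setT (EFin \o value_at_renewal xi Z 1) ->
  {ae P, forall w, (max_first_cycle xi Z w < +oo)%E} ->
  let mu := fine (\int[P]_w (xi 0%N w)%:E) in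
  let a := fine (\int[P]_w (value_at_renewal xi Z 1 w)%:E) / mu in
  cvg_in_probability P (fun t w => Z t w / t) a.
Proof.
move=> hxi [mZ cZ] hreg ixi iV M1oo mu a e e0; have [[mxi _ _] xi0] := hxi.
have [Z0 iidz] := hreg; have [minc _ _] := iidz.
have mu0 : 0 < mu by apply: mean_gt0.
pose nu := mu / 2; have nu0 : 0 < nu by rewrite divr_gt0.
(* The sum contributes e' (t / nu) = e t / 4, and K will be below e t / 2. *)
pose e' := e * nu / 4; have e'0 : 0 < e' by rewrite !mulr_gt0 ?invr_gt0.
pose S n w := \sum_(i < n) path_centered a (increment xi Z i w).
have mS n : measurable_fun setT (S n).
  exact: (measurable_epoch n minc (measurable_path_centered a)).
have mT n : measurable_fun setT (renewal_time xi n).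
  exact: (measurable_epoch n minc (@measurable_fst _ _ _ _)).
pose bad n := [set w | e' * n%:R < `|S n w|] `|`
  [set w | renewal_time xi n w < nu * n%:R].
have mbad n : measurable (bad n).
  apply: measurableU.
    rewrite (_ : [set w | _] =
        setT `&` (fun w => `|S n w|) @^-1` `]e' * n%:R, +oo[).
      exact: measurableT_comp.
    by rewrite setTI; apply/seteqP; split=> w /=; rewrite in_itv/= andbT.
  rewrite (_ : [set w | _] =
      setT `&` renewal_time xi n @^-1` `]-oo, (nu * n%:R)[).
    exact: mT.
  by rewrite setTI; apply/seteqP; split=> w /=; rewrite in_itv.
pose G m := \bigcup_(n in [set n | (m <= n)%N]) bad n.
have mG m : measurable (G m) by apply: bigcup_measurable => n _.
have G0 : {ae P, forall w, \forall m \near \oo, ~ G m w}.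
  apply: filterS2 (centered_sum_average xi0 hreg ixi iV)
    (renewal_time_near hxi ixi) => w cw [m2 _ Tw].
  have [m1 _ Sw] := average_near cw e'0.
  near=> m => -[n /= mn]; case=> /=; apply/negP; rewrite -leNgt.
    have := Sw n; rewrite mul0r subr0; apply; apply: leq_trans mn.
    by near: m; exact: nbhs_infty_ge.
  by apply: Tw; apply: leq_trans mn; near: m; exact: nbhs_infty_ge.
have mD t : 0 < t -> measurable [set w | e <= `|Z t w / t - a|].
  move=> t0; rewrite (_ : [set w | _] =
      setT `&` (fun w => `|Z t w / t - a|) @^-1` `[e, +oo[).
    apply: measurableT_comp => //; first apply: measurable_funB => //.
    by apply: measurable_funM => //; exact: mZ (ltW t0).
  by rewrite setTI; apply/seteqP; split=> w /=; rewrite in_itv/= andbT.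
apply/fine_cvgP; split.
  near=> t; rewrite fin_num_measure//; apply: mD.
  by near: t; apply: nbhs_pinfty_gt; rewrite num_real.
apply/cvgrPdist_le => /= h h0.
have h30 : 0 < h / 3 by rewrite divr_gt0.
have [m PG] := probability_vanishing mG h30 G0.
have [K PE] := covering_deviation_small a hxi cZ hreg ixi M1oo h30.
pose L (k : nat) := [set w | k%:R < renewal_time xi m w].
have mL k : measurable (L k).
  rewrite (_ : L k = setT `&` renewal_time xi m @^-1` `]k%:R, +oo[).
    exact: mT.
  by rewrite setTI; apply/seteqP; split=> w /=; rewrite in_itv/= andbT.
have [k PL] : exists k, (P (L k) <= (h / 3)%:E)%E.
  apply: probability_vanishing => //; apply: aeW => w.
  near=> k; rewrite /L/=; apply/negP; rewrite -leNgt.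
  by near: k; exact: nbhs_infty_ger.
near=> t.
have t0 : 0 < t by near: t; apply: nbhs_pinfty_gt; rewrite num_real.
have kt : k%:R <= t by near: t; apply: nbhs_pinfty_ge; rewrite num_real.
have Kt : K%:R < t * (e / 2).
  rewrite -ltr_pdivrMr ?divr_gt0//.
  by near: t; apply: nbhs_pinfty_gt; rewrite num_real.
have {}PE := PE t; move: PE; set Et := [set w | exists n, _] => PE.
have {}mD := mD t t0; move: mD; set D := [set w | _] => mD.
have mEt : measurable Et.
  exact: (measurable_covering_event t minc (@measurable_fst _ _ _ _)
    (measurable_large_deviation a K)).
have DE : D `<=` G m `|` L k `|` Et.
  move=> w Dw; apply: contrapT => /not_orP[/not_orP[nG nL] nE].
  have Sm n : (m <= n)%N -> `|S n w| <= e' * n%:R.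
    move=> mn; rewrite leNgt; apply/negP => Sn; apply: nG.
    by exists n => //; left.
  have Tm n : (m <= n)%N -> nu * n%:R <= renewal_time xi n w.
    move=> mn; rewrite leNgt; apply/negP => Tn; apply: nG.
    by exists n => //; right.
  have Tt : renewal_time xi m w <= t.
    by apply: le_trans kt; rewrite leNgt; apply/negP.
  have [n [_ nt _ Zt]] :=
    regenerative_bound xi0 (cZ w) (Z0 w) nu0 (ltW e'0) Sm Tm Tt.
  have devK : (path_deviation a (increment xi Z n w) <= K%:R%:E)%E.
    by rewrite leNgt; apply/negP => Kdev; apply: nE; exists n.
  have : (`|Z t w - a * t|%:E <= (e' * (t / nu))%:E + K%:R%:E)%E.
    by apply: (le_trans Zt); rewrite leeD2l.
  rewrite -EFinD lee_fin => {}Zt; move: Dw; rewrite /D /=.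
  have -> : Z t w / t - a = (Z t w - a * t) / t by field; rewrite gt_eqF.
  rewrite normrM normfV (gtr0_norm t0) ler_pdivlMr// => /le_trans/(_ Zt).
  have -> : e' * (t / nu) = e * t / 4 by rewrite /e'; field; rewrite gt_eqF.
  have : 0 < e * t by rewrite mulr_gt0.
  by move: Kt; rewrite mulrCA -mulrA mulrC; lra.
have PD : (P D <= h%:E)%E.
  apply: (@le_trans _ _ (P (G m `|` L k `|` Et))).
    by apply: le_measure => //; rewrite inE//; do 2 apply: measurableU => //.
  apply: le_trans (measureU2 _ _ _) _ => //; first exact: measurableU.
  have -> : h = h / 3 + h / 3 + h / 3 by field.
  rewrite 2!EFinD leeD//.
  by apply: le_trans (measureU2 _ _ _) _ => //; rewrite leeD.
rewrite sub0r normrN ger0_norm ?fine_ge0//.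
by rewrite -lee_fin fineK// fin_num_measure.
Unshelve. all: end_near. Qed.

Theorem theorem4p1 (d : measure_display) (T : measurableType d) (R : realType)
    (P : probability T R) (xi : nat -> T -> R) (Z : R -> T -> R)
    (hxi : renewal_process P xi)
    (hZ : cadlag_process Z)
    (hreg : regenerative_increments P xi Z)
    (hmu : P.-integrable setT (EFin \o renewal_time xi 1))
    (ha : P.-integrable setT (EFin \o value_at_renewal xi Z 1)) :
  let mu := fine ('E_P[renewal_time xi 1])%E in
  let a := fine ('E_P[value_at_renewal xi Z 1])%E / mu in
  let M1 := max_first_cycle xi Z in
  ({ae P, forall w, (M1 w < +oo)%E} ->
     cvg_in_probability P (fun t w => Z t w / t) a) /\
  ((\int[P]_w M1 w < +oo)%E ->
     {ae P, forall w, Z t w / t @[t --> +oo%R] --> a}).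
Proof.
have T1 : renewal_time xi 1 = xi 0%N.
  by apply/funext => w; rewrite /renewal_time big_ord1.
have EE (X : T -> R) : ('E_P[X] = \int[P]_w (X w)%:E)%E by rewrite unlock.
move: hmu; rewrite T1 !EE => ixi mu a M1; split=> M1oo.
  exact: (regenerative_weak_law hxi hZ hreg ixi ha M1oo).
have [_ cZ] := hZ.
exact: (regenerative_strong_law hxi cZ hreg ixi ha M1oo).
Qed.
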